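(* Let $\sigma\in\mathcal{W}_{2,ac}(\mathbb{R}^n)$ and $\mu\in\mathcal{W}_2(\mathbb{R}^n)$, and let $P\in O(n)$. For $\eta\in\{\mu,\ \mathcal{U}(\sigma,\mu,P)\}$ the minimization problem $$S_t^{\sigma,\eta,W_2}:=\operatorname*{arg\,min}_{S\in\mathcal{S}_t}W_2(S_\sharp\sigma,\eta),\qquad \mathcal{S}_t=\{x\mapsto x+b\mid b\in\mathbb{R}^n\},$$ has a unique minimizer, and $$S_t^{\sigma,\mu,W_2}=S_t^{\sigma,\mathcal{U}(\sigma,\mu,P),W_2}.$$
   Context: $\mathcal{W}_2(\mathbb{R}^n)$ is the set of Borel probability measures on $\mathbb{R}^n$ with finite second moment, and $\mathcal{W}_{2,ac}(\mathbb{R}^n)$ the subset of those absolutely continuous with respect to Lebesgue measure. $\sharp$ denotes pushforward. $W_2(\alpha,\beta)=\inf_\pi(\int\|x-y\|^2d\pi(x,y))^{1/2}$ over couplings $\pi$ of $\alpha,\beta$. For $\theta\in S^{n-1}$, $\sigma^\theta$ is the pushforward of $\sigma$ under $x\mapsto x\cdot\theta$. For one-dimensional measures $\alpha$ (absolutely continuous) and $\beta$, $T_\alpha^\beta=F_\beta^{-1}\circ F_\alpha$ is the optimal transport map ($F_\alpha$ the cumulative distribution function, $F_\beta^{-1}$ the quantile function), i.e. the $\alpha$-a.e. unique nondecreasing map pushing $\alpha$ to $\beta$. For $P=[\theta_1,\ldots,\theta_n]\in O(n)$ (orthogonal matrix with columns $\theta_i$), $T_{\sigma,\mu;P}(x)=\sum_{i=1}^nT_{\sigma^{\theta_i}}^{\mu^{\theta_i}}(x\cdot\theta_i)\,\theta_i$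 and $\mathcal{U}(\sigma,\mu,P)=(T_{\sigma,\mu;P})_\sharp\sigma$. *)

(* Defs.v *)
From HB Require Import structures.
From mathcomp Require Import all_boot all_order all_algebra.
From mathcomp Require Import all_classical all_reals all_analysis.

Set Implicit Arguments.
Unset Strict Implicit.
Unset Printing Implicit Defensive.

Import Order.TTheory GRing.Theory Num.Theory.
Import numFieldNormedType.Exports.

Local Open Scope classical_set_scope.
Local Open Scope ring_scope.

(* R^n is 'cV[R]_n with the Borel sigma-algebra of the library's topology on
   matrices (the product topology). *)
Definition borel_mx_display : measure_display.
Proof. exact. Qed.

HB.instance Definition _ (R : realType) (m n : nat) :=
  @isMeasurable.Build borel_mx_display 'M[R]_(m, n)
    <<s @open 'M[R]_(m, n) >>
    (@sigma_algebra0 _ setT _) (@sigma_algebraC _ _)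
    (@sigma_algebra_bigcup _ setT _).

(* The library's norm `|x| on 'cV[R]_n is the sup norm, hence these. *)
Definition dotv (R : realType) (n : nat) (x y : 'cV[R]_n) : R :=
  \sum_(i < n) x i 0 * y i 0.

Definition enorm (R : realType) (n : nat) (x : 'cV[R]_n) : R :=
  Num.sqrt (dotv x x).

(* n-dimensional Lebesgue outer measure by countable box coverings; on Borel
   sets, for 0 < n, its values are those of Lebesgue measure (for n = 0 no box
   is empty and the formula is degenerate). *)
Definition box (R : realType) (n : nat) (a b : 'cV[R]_n) : set 'cV[R]_n :=
  [set x | forall i, a i 0 < x i 0 <= b i 0].

Definition box_vol (R : realType) (n : nat) (a b : 'cV[R]_n) : R :=
  \prod_(i < n) Num.max 0 (b i 0 - a i 0).

Definition lebesgue_n (R : realType) (n : nat) (A : set 'cV[R]_n) : \bar R :=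
  ereal_inf [set (\sum_(k <oo) (box_vol (ab.1 k) (ab.2 k))%:E)%E
            | ab in [set ab : (nat -> 'cV[R]_n) * (nat -> 'cV[R]_n) |
                A `<=` \bigcup_k box (ab.1 k) (ab.2 k)]].

Definition W2space (R : realType) (n : nat) : set (probability 'cV[R]_n R) :=
  [set mu | (\int[mu]_x (enorm x ^+ 2)%:E < +oo)%E].

Definition W2ac (R : realType) (n : nat) : set (probability 'cV[R]_n R) :=
  [set mu | W2space mu /\
    forall A : set 'cV[R]_n, measurable A -> lebesgue_n A = 0%E -> mu A = 0%E].

(* Here and below measures are passed as plain set functions, so that a
   pushforward can be written without packing a measurability proof. *)
Definition coupling (R : realType) (n : nat) (alpha beta : set 'cV[R]_n -> \bar R) :
    set (probability ('cV[R]_n * 'cV[R]_n)%type R) :=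
  [set pi | forall A : set 'cV[R]_n, measurable A ->
    pi (fst @^-1` A) = alpha A /\ pi (snd @^-1` A) = beta A].

Definition W2 (R : realType) (n : nat) (alpha beta : set 'cV[R]_n -> \bar R) :
    \bar R :=
  ereal_inf
    [set ((\int[pi]_z (enorm (z.1 - z.2) ^+ 2)%:E) `^ 2^-1)%E
    | pi in coupling alpha beta].

Definition slice (R : realType) (n : nat) (sigma : set 'cV[R]_n -> \bar R)
    (theta : 'cV[R]_n) : set R -> \bar R :=
  pushforward sigma (fun x => dotv x theta).

Definition cdf1 (R : realType) (alpha : set R -> \bar R) (t : R) : \bar R :=
  alpha `]-oo, t]%classic.

(* Real-valued: inf is 0 on sets that are empty or unbounded below. For beta a
   probability and p in [0, 1] this happens only at p = 0 and p = 1, levels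
   that cdf1 alpha reaches on an alpha-null set only when alpha is atomless. *)
Definition quantile (R : realType) (beta : set R -> \bar R) (p : \bar R) : R :=
  inf [set t : R | (p <= cdf1 beta t)%E].

Definition transport1 (R : realType) (alpha beta : set R -> \bar R) : R -> R :=
  quantile beta \o cdf1 alpha.

Definition orthogonal_group (R : realType) (n : nat) : set 'M[R]_n :=
  [set P | P^T *m P = 1%:M].

Definition slice_transport (R : realType) (n : nat)
    (sigma mu : set 'cV[R]_n -> \bar R) (P : 'M[R]_n) (x : 'cV[R]_n) : 'cV[R]_n :=
  \sum_(i < n)
    transport1 (slice sigma (col i P)) (slice mu (col i P)) (dotv x (col i P))
      *: col i P.

Definition slice_matching (R : realType) (n : nat)
    (sigma mu : set 'cV[R]_n -> \bar R) (P : 'M[R]_n) : set 'cV[R]_n -> \bar R :=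
  pushforward sigma (slice_transport sigma mu P).

Definition translations (R : realType) (n : nat) : set ('cV[R]_n -> 'cV[R]_n) :=
  range (fun (b x : 'cV[R]_n) => x + b).

Definition W2_argmin (R : realType) (n : nat) (D : set ('cV[R]_n -> 'cV[R]_n))
    (sigma eta : set 'cV[R]_n -> \bar R) : set ('cV[R]_n -> 'cV[R]_n) :=
  [set S | D S /\ forall S', D S' ->
    (W2 (pushforward sigma S) eta <= W2 (pushforward sigma S') eta)%E].

(* Main.v *)
(* Shifting a coupling of (sigma + b) and eta by v is a coupling of
   (sigma + b + v) and eta, and expanding the square shows that
     W2(sigma + b, eta)^2 = W2(sigma + b0, eta)^2 + |b - b0|^2
   with b0 = mean eta - mean sigma: the cross term vanishes because sigma + b0
   and eta have the same mean.  So translation by b0 is the unique minimizer, and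
   it depends on eta only through its mean.

   As P is orthogonal, the i-th slice of U(sigma, mu, P) is the image of the i-th
   slice of sigma under the monotone transport to the i-th slice of mu, that is,
   the i-th slice of mu itself.  The mean and the second moment are determined by
   the slices along an orthonormal basis, hence U(sigma, mu, P) is in W2 and has
   the mean of mu.  Absolute continuity of sigma is used only to see that its
   slices are atomless: hyperplanes are Lebesgue null. *)
Require Import Defs.
From mathcomp Require Import all_boot all_order all_algebra.
From mathcomp Require Import all_classical all_reals all_analysis.
From HB Require Import structures.
From mathcomp Require Import measurable_realfun.
From mathcomp Require Import ring lra.

Set Implicit Arguments.
Unset Strict Implicit.
Unset Printing Implicit Defensive.

Import Order.TTheory GRing.Theory Num.Theory.
Import numFieldNormedType.Exports.

Local Open Scope classical_set_scope.
Local Open Scope ring_scope.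

(** * Borel sets of R^n *)

(** Bundled as a probability so that it can be integrated against; it stays convertible with the
    plain [pushforward]. *)
Definition pushforward_probability d d' (T : measurableType d)
    (T' : measurableType d') (R : realType) (P : probability T R) (f : T -> T')
    (mf : measurable_fun setT f) : probability T' R :=
  distribution P (mfun_Sub (mem_set mf) : {mfun T >-> T'}).

Lemma pushforward_probabilityE d d' (T : measurableType d)
    (T' : measurableType d') (R : realType) (P : probability T R) (f : T -> T')
    (mf : measurable_fun setT f) :
  pushforward_probability P mf = pushforward P f :> (set T' -> \bar R).
Proof. by []. Qed.

Section colvec.
Context {R : realType} {n : nat}.

Lemma measurable_coord (i : 'I_n) :
  measurable_fun setT (fun x : 'cV[R]_n => x i 0).
Proof.
apply: (@measurability _ _ _ (measurableTypeR R) _ _ _ (RGenOpens.measurableE R)).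
move=> _ [_ [a [b ->]] <-]; rewrite setTI; apply: sub_sigma_algebra.
apply: open_comp => [x _|]; first exact: coord_continuous.
exact: interval_open.
Qed.

(** A countable base: if a rational centre is within [1/(k+1) < e/2] of [x], its ball of that radius
    contains [x] and lies in the [e]-ball around [x]. *)
Lemma open_bigcup_rat_balls (U : set 'cV[R]_n) : open U ->
  U = \bigcup_(p in [set p : 'cV[rat]_n * nat |
        ball (map_mx ratr p.1 : 'cV[R]_n) p.2.+1%:R^-1 `<=` U])
      ball (map_mx ratr p.1 : 'cV[R]_n) p.2.+1%:R^-1.
Proof.
move=> oU; apply/seteqP; split=> [x Ux|x [p Up]]; last exact: Up.
have /nbhs_ballP[e e0 eU] : nbhs x U by exact: open_nbhs_nbhs.
have [k _ ke] : exists2 k, True & k.+1%:R^-1 < e / 2.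
  have /= := near_infty_natSinv_lt (PosNum (divr_gt0 e0 (ltr0Sn R 1))).
  by case=> k _ /(_ k (leqnn k)); exists k.
have q_ i : exists q : rat, ball (x i 0) k.+1%:R^-1 (ratr q).
  have [|q] := @rat_in_itvoo R (x i 0 - k.+1%:R^-1) (x i 0 + k.+1%:R^-1).
    by rewrite ltrBlDr -addrA ltrDl addr_gt0// invr_gt0.
  by rewrite in_itv/= => xq; exists q; rewrite ball_itv/= in_itv.
have [q xq] := choice q_.
have xb : ball (map_mx ratr (\col_i q i) : 'cV[R]_n) k.+1%:R^-1 x.
  split; first by rewrite invr_gt0.
  by move=> i j; rewrite !mxE (ord1 j); apply: ball_sym; exact: xq.
exists (\col_i q i, k) => //= y xy; apply: eU.
apply: (@le_ball _ _ _ (k.+1%:R^-1 + k.+1%:R^-1)).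
  by rewrite (splitr e) lerD// ltW.
by apply: ball_triangle xy; apply: ball_sym.
Qed.

(** Balls of the sup norm are products of intervals, so their preimages are finite intersections of
    coordinate preimages; open sets are countable unions of such balls. *)
Lemma measurable_col d (T : measurableType d) (f : T -> 'cV[R]_n) :
  (forall i, measurable_fun setT (fun t => f t i 0)) -> measurable_fun setT f.
Proof.
move=> mf.
have mb (y : 'cV[R]_n) (e : R) : 0 < e -> measurable (f @^-1` ball y e).
  move=> e0.
  have -> : f @^-1` ball y e =
      \bigcap_(i in [set: 'I_n]) ((fun t => f t i 0) @^-1` ball (y i 0) e).
    apply/seteqP; split=> t /=; first by move=> [_ h] i _; exact: h.
    by move=> h; split=> // i j; rewrite (ord1 j); exact: h.
  apply: fin_bigcap_measurable => // i _.
  by rewrite -[X in measurable X]setTI; apply: mf => //; exact: measurable_ball.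
apply: (@measurability _ _ _ _ _ _ (@open 'cV[R]_n)) => //.
move=> _ [U oU <-]; rewrite setTI (open_bigcup_rat_balls oU) preimage_bigcup.
rewrite bigcup_mkcond; apply: countable_bigcupT_measurable => [|p].
  exact: countableP.
by case: ifPn => // _; apply: mb; rewrite invr_gt0.
Qed.

Lemma measurable_dotv d (T : measurableType d) (f g : T -> 'cV[R]_n) :
  measurable_fun setT f -> measurable_fun setT g ->
  measurable_fun setT (fun t => dotv (f t) (g t)).
Proof.
move=> mf mg; apply: measurable_sum => i; apply: measurable_funM.
  exact: (measurableT_comp (measurable_coord i) mf).
exact: (measurableT_comp (measurable_coord i) mg).
Qed.

Lemma measurable_colD d (T : measurableType d) (f g : T -> 'cV[R]_n) :
  measurable_fun setT f -> measurable_fun setT g ->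
  measurable_fun setT (fun t => f t + g t).
Proof.
move=> mf mg; apply: measurable_col => i.
under eq_fun do rewrite mxE.
apply: measurable_funD.
  exact: (measurableT_comp (measurable_coord i) mf).
exact: (measurableT_comp (measurable_coord i) mg).
Qed.

Lemma measurable_colB d (T : measurableType d) (f g : T -> 'cV[R]_n) :
  measurable_fun setT f -> measurable_fun setT g ->
  measurable_fun setT (fun t => f t - g t).
Proof.
move=> mf mg; apply: measurable_col => i.
under eq_fun do rewrite !mxE.
apply: measurable_funB.
  exact: (measurableT_comp (measurable_coord i) mf).
exact: (measurableT_comp (measurable_coord i) mg).
Qed.

Lemma enorm_sqr (x : 'cV[R]_n) : enorm x ^+ 2 = dotv x x.
Proof. by rewrite sqr_sqrtr// sumr_ge0// => i _; rewrite -expr2 sqr_ge0. Qed.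

End colvec.

(** * Hyperplanes are null *)

Lemma box_vol_ge0 (R : realType) n (a b : 'cV[R]_n) : 0 <= box_vol a b.
Proof. by apply: prodr_ge0 => i _; rewrite le_max lexx. Qed.

Lemma lebesgue_n_ge0 (R : realType) n (A : set 'cV[R]_n) :
  (0 <= lebesgue_n A)%E.
Proof.
apply: le_ereal_inf_tmp => _ [ab _ <-].
by apply: nneseries_ge0 => k _ _; rewrite lee_fin box_vol_ge0.
Qed.

Lemma lebesgue_n_fin_cover (R : realType) m (I : finType)
    (a b : I -> 'cV[R]_m.+1) (A : set 'cV[R]_m.+1) :
  A `<=` [set x | exists i, box (a i) (b i) x] ->
  (lebesgue_n A <= (\sum_i box_vol (a i) (b i))%:E)%E.
Proof.
move=> Aab.
(* The finite family is padded to a sequence by the boxes [box 0 0], which have volume 0 because the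
   dimension is positive. *)
pose F k := nth None [seq Some i | i <- enum I] k.
pose ab (c : I -> 'cV[R]_m.+1) k := if F k is Some i then c i else 0.
apply: ereal_inf_lbound; exists (ab a, ab b).
  move=> x /Aab[i xi]; exists (index i (enum I)) => //=.
  rewrite /ab /F (nth_map i) ?index_mem ?mem_enum// nth_index ?mem_enum//.
pose vol k := (box_vol (ab a k) (ab b k))%:E.
rewrite (nneseries_split 0 #|I|)//=; last first.
  by move=> k _; rewrite lee_fin box_vol_ge0.
rewrite [X in (_ + X)%E]eseries0 ?adde0; last first.
  move=> k; rewrite add0n cardE => Ik _.
  rewrite /ab /F nth_default ?size_map -?enumT//.
  by rewrite /box_vol big_ord_recl mxE subrr maxxx mul0r.
rewrite -sumEFin add0n big_mkord.
rewrite [RHS](reindex_onto (@enum_val _ I) enum_rank) /=; last first.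
  by move=> i _; exact: enum_rankK.
rewrite [RHS](eq_bigl xpredT); last by move=> k /=; rewrite enum_valK eqxx.
apply: eq_bigr => k _; congr (_%:E).
suff Fk : F k = Some (enum_val k) by rewrite /ab Fk.
rewrite /F (nth_map (enum_val k)) -?cardE//.
by congr Some; apply/esym; exact: enum_val_nth.
Qed.

Lemma grid_cell (R : realType) (M K : nat) (y : R) : 0 < y <= M%:R ->
  exists k : 'I_(M * K.+1), k%:R / K.+1%:R < y <= k.+1%:R / K.+1%:R.
Proof.
move=> /andP[y0 yM].
have exk : exists k, y <= k%:R / K.+1%:R.
  exists (M * K.+1)%N; rewrite natrM mulfK//.
(* The least grid point at or above [y] closes the cell, so the cell has index [k.-1]; [0 < y] makes
   [k] positive. *)
have [k yk kmin] := ex_minnP exk.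
have k0 : (0 < k)%N.
  by case: k yk {kmin} => // ; rewrite mul0r leNgt y0.
have kMK : (k.-1 < M * K.+1)%N.
  by rewrite prednK//; apply: kmin; rewrite natrM mulfK.
exists (Ordinal kMK) => /=; rewrite prednK// yk andbT ltNge.
by apply/negP => /kmin; rewrite leqNgt prednK// leqnn.
Qed.

Lemma lebesgue_n_hyperplane_cube (R : realType) m (theta : 'cV[R]_m.+1)
    (j : 'I_m.+1) (c : R) (N : nat) : theta j 0 != 0 ->
  lebesgue_n [set x : 'cV[R]_m.+1 | dotv x theta = c /\
    forall i, - N%:R < x i 0 <= N%:R] = 0%E.
Proof.
move=> tj0; set A := [set x | _].
(* Cut the other m coordinates into cubes of side 1/(K+1); over each cube the
   hyperplane is a graph staying within (L - 1)/(K+1) of its value g at the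
   corner, hence is covered by a box of height 2L/(K+1). *)
pose L : R := \sum_(l < m) `|theta (lift j l) 0 / theta j 0| + 1.
have L0 : 0 < L by rewrite ltr_wpDl ?sumr_ge0.
(* There will be [((N + N) * K.+1) ^ m] boxes of volume [(L + L) * h ^ m.+1] with [h = 1/(K+1)], in
   total [C / K.+1]. *)
pose C : R := (N + N)%:R ^+ m * (L + L).
have C0 : 0 <= C.
  by apply: mulr_ge0; [exact: exprn_ge0|rewrite addr_ge0 ?(ltW L0)].
suff AC : forall K : nat, (lebesgue_n A <= (C / K.+1%:R)%:E)%E.
  apply/eqP; rewrite eq_le lebesgue_n_ge0 andbT.
  apply/lee_addgt0Pr => e e0; rewrite add0e.
  have Ce : 0 < e / (C + 1) by rewrite divr_gt0 ?ltr_wpDl.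
  have /= := near_infty_natSinv_lt (PosNum Ce).
  case=> K _ /(_ K (leqnn K)) /= Ke.
  apply: le_trans (AC K) _; rewrite lee_fin.
  apply: (@le_trans _ _ ((C + 1) * K.+1%:R^-1)).
    by rewrite ler_wpM2r ?invr_ge0 ?lerDl.
  by move: (ltW Ke); rewrite ler_pdivlMr ?ltr_wpDl// mulrC.
move=> K; pose h : R := K.+1%:R^-1.
have h0 : 0 < h by rewrite invr_gt0.
pose p (f : {ffun 'I_m -> 'I_((N + N) * K.+1)}) l : R := - N%:R + (f l)%:R * h.
pose g f : R := (c - \sum_(l < m) p f l * theta (lift j l) 0) / theta j 0.
pose a f : 'cV[R]_m.+1 :=
  \col_i if unlift j i is Some l then p f l else g f - L * h.
pose b f : 'cV[R]_m.+1 :=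
  \col_i if unlift j i is Some l then p f l + h else g f + L * h.
have -> : C / K.+1%:R = \sum_f box_vol (a f) (b f).
  have vf f : box_vol (a f) (b f) = (L + L) * h * h ^+ m.
    rewrite /box_vol (bigD1_ord j)//= !mxE unlift_none.
    rewrite (eq_bigr (fun=> h)) => [|l _]; last first.
      by rewrite !mxE liftK; rewrite max_r; [ring|rewrite addrAC subrr add0r ltW].
    rewrite prodr_const card_ord; congr (_ * _).
    rewrite max_r; first by ring.
    have := mulr_gt0 L0 h0; lra.
  rewrite (eq_bigr _ (fun f _ => vf f)) sumr_const card_ffun !card_ord.
  rewrite -[RHS]mulr_natr natrX natrM /C exprMn -/h.
  have : h ^+ m * K.+1%:R ^+ m = 1.
    by rewrite -exprMn mulVf ?expr1n.
  by move=> hK; rewrite -[LHS]mulr1 -[X in _ * X = _]hK; ring.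
apply: lebesgue_n_fin_cover => x [xc xN].
(* Adding [N] moves the coordinates into []0, 2N]], the range of the grid. *)
have /choice[f xf] (l : 'I_m) : exists k : 'I_((N + N) * K.+1),
    k%:R / K.+1%:R < x (lift j l) 0 + N%:R <= k.+1%:R / K.+1%:R.
  apply: grid_cell; rewrite natrD; have /andP[] := xN (lift j l); lra.
exists [ffun l => f l] => i; rewrite !mxE; case: unliftP => [l ->|->].
  rewrite /p ffunE; have := xf l; rewrite -[(f l).+1%:R]natr1 mulrDl mul1r -/h.
  lra.
set q := p [ffun l => f l]; set G := g [ffun l => f l].
(* The equation of the hyperplane, solved for [x j 0] and compared with its solution [G] at the
   corner of the cell. *)
have -> : x j 0 = G - \sum_(l < m)
    (x (lift j l) 0 - q l) * (theta (lift j l) 0 / theta j 0).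
  rewrite /G /g -xc /dotv (bigD1_ord j)//= -/q.
  apply: (mulIf tj0); rewrite mulrBl mulfVK//.
  rewrite mulr_suml.
  rewrite [X in _ = _ - X](eq_bigr (fun l =>
    x (lift j l) 0 * theta (lift j l) 0 - q l * theta (lift j l) 0)); last first.
    by move=> l _; field.
  by rewrite sumrB; ring.
set S := \sum_(l < m) _.
(* The summand 1 in [L] makes this strict, even for [m = 0]; boxes exclude their lower faces. *)
have : `|S| < L * h.
  rewrite /L mulrDl mul1r mulr_suml.
  apply: (@le_lt_trans _ _
    (\sum_(l < m) `|theta (lift j l) 0 / theta j 0| * h)); last by rewrite ltrDl.
  apply: le_trans (ler_norm_sum _ _ _) _; apply: ler_sum => l _.
  rewrite normrM mulrC ler_wpM2l//.
  rewrite /q /p ffunE ler_norml; have := xf l.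
  rewrite -[(f l).+1%:R]natr1 mulrDl mul1r -/h.
  lra.
by rewrite ltr_norml; lra.
Qed.

(** The mass in question is that of a hyperplane, a countable union of bounded Borel pieces to each
    of which absolute continuity applies. *)
Lemma slice_atomless (R : realType) m (sigma : probability 'cV[R]_m.+1 R)
    (theta : 'cV[R]_m.+1) (c : R) : W2ac sigma -> theta != 0 ->
  slice sigma theta [set c] = 0%E.
Proof.
move=> [_ sac] t0.
have [j tj0] : exists j, theta j 0 != 0.
  apply/existsP; apply: contraNT t0; rewrite negb_exists => /forallP h.
  by apply/eqP/colP => j; rewrite mxE; apply/eqP; rewrite -[_ == _]negbK.
pose A N := [set x : 'cV[R]_m.+1 | dotv x theta = c /\
    forall i, - N%:R < x i 0 <= N%:R].
have mA N : measurable (A N).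
  have -> : A N = (fun x => dotv x theta) @^-1` [set c] `&`
      \bigcap_(i in [set: 'I_m.+1]) ((fun x => x i 0) @^-1` `]- N%:R, N%:R]).
    apply/seteqP; split=> x /= [xc xN]; split=> // i.
      by move=> _ /=; rewrite in_itv; exact: xN.
    by have := xN i Logic.I; rewrite /= in_itv.
  apply: measurableI.
    rewrite -[X in measurable X]setTI; apply: measurable_dotv => //.
  apply: fin_bigcap_measurable => // i _.
  by rewrite -[X in measurable X]setTI; exact: measurable_coord.
have -> : slice sigma theta [set c] = sigma (\bigcup_N A N).
  congr (sigma _); apply/seteqP; split=> [x xc|x [N _ []//]].
  pose M : R := \sum_i `|x i 0|.
  exists (Num.bound M) => //; split=> // i.
  have : `|x i 0| < (Num.bound M)%:R.
    apply: (@le_lt_trans _ _ M); last by rewrite archi_boundP// sumr_ge0.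
    by rewrite /M (bigD1 i)//= lerDl sumr_ge0.
  by rewrite ltr_norml => /andP[-> /ltW].
apply/negligibleP; first exact: bigcupT_measurable.
apply: negligible_bigcup => N; apply/negligibleP => //.
by apply: sac => //; exact: lebesgue_n_hyperplane_cube tj0.
Qed.

(** * One-dimensional transport *)

(** The complementary rays []x, +oo[] form a generating family stable under intersection, so
    uniqueness of measures applies. *)
Lemma probability_cdf_eq (R : realType) (P Q : probability R R) :
  (forall c, P `]-oo, c]%classic = Q `]-oo, c]%classic) ->
  forall A, measurable A -> P A = Q A.
Proof.
move=> PQ A mA.
have PQC x : P `]x, +oo[%classic = Q `]x, +oo[%classic.
  by rewrite -setCitvl !probability_setC ?PQ.
pose g (k : nat) : set R := `](- k%:R : R), +oo[%classic.
apply: (@measure_unique _ R R (@RGenOInfty.G R) g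
  (RGenOInfty.measurableE R) _ _ _ P Q) => //.
- move=> _ _ [x ->] [y ->]; exists (Num.max x y).
  apply/seteqP; split=> z /=; rewrite !in_itv/= !andbT gt_max.
    by case=> -> ->.
  by move=> /andP.
- by move=> k; exists (- k%:R).
- apply/seteqP; split=> // x _; exists (Num.bound `|x|) => //=.
  rewrite /g/= in_itv/= andbT ltrNl (le_lt_trans (ler_norm _))// normrN.
  exact: archi_boundP.
- by move=> _ [x ->]; exact: PQC.
- move=> k.
  exact: (le_lt_trans (probability_le1 P (measurable_itv _)) (ltry 1)).
Qed.

(** * Distribution functions and quantiles *)

Section cdf.
Context {R : realType}.
Implicit Types P : probability R R.

Lemma cdf1_nondecreasing P : {homo cdf1 P : x y / x <= y >-> (x <= y)%E}.
Proof. by move=> x y xy; rewrite le_measure ?inE//; exact: subitvPr. Qed.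

Lemma cdf1_ge0 P x : (0 <= cdf1 P x)%E.
Proof. exact: measure_ge0. Qed.

Lemma cdf1_le1 P x : (cdf1 P x <= 1)%E.
Proof. exact: probability_le1. Qed.

(** The identity, seen as a random variable on R with law [P], has [cdf1 P] as its distribution
    function; this gives access to the limits and the right continuity of [cdf]. *)
Let idTR : R -> R := idfun.

#[local] HB.instance Definition _ :=
  @isMeasurableFun.Build _ _ _ _ idTR (@measurable_id _ _ setT).

Lemma cdf1_sup P (p : \bar R) : (forall x, cdf1 P x <= p)%E -> (1 <= p)%E.
Proof.
move=> Pp; apply: (cvge_to_le (@cvg_cdfy1 _ _ _ P idTR)).
exact: nearW.
Qed.

Lemma cdf1_inf P (p : \bar R) : (forall x, p <= cdf1 P x)%E -> (p <= 0)%E.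
Proof.
move=> Pp; apply: (cvge_to_ge (@cvg_cdfNy0 _ _ _ P idTR)).
exact: nearW.
Qed.

Lemma cdf1_right_ge P (p : \bar R) s :
  (forall x, s < x -> (p <= cdf1 P x)%E) -> (p <= cdf1 P s)%E.
Proof.
move=> Pp; apply: (cvge_to_ge (@cdf_right_continuous _ _ _ P idTR s)).
by near=> x; apply: Pp; near: x; exact: nbhs_right_gt.
Unshelve. all: by end_near. Qed.

(** The mass of the open ray is the left limit of the distribution function, by continuity from
    below along [s - 1/(k+1)]. *)
Lemma cdf1_left_le P (p : \bar R) s :
  (forall x, x < s -> (cdf1 P x <= p)%E) -> (P `]-oo, s[%classic <= p)%E.
Proof.
move=> Pp.
have -> : `]-oo, s[%classic = \bigcup_k `]-oo, s - k.+1%:R^-1]%classic.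
  rewrite -setCitvr itvcyEbigcap setC_bigcap; apply: eq_bigcupr => k _.
  by rewrite setCitvr.
pose F (k : nat) := `]-oo, s - k.+1%:R^-1]%classic.
have /cvge_to_le : P (F k) @[k --> \oo] --> P (\bigcup_k F k); last first.
  by apply; apply: nearW => k; apply: Pp; rewrite ltrBlDr ltrDl invr_gt0.
have mF k : measurable (F k) by exact: measurable_itv.
apply: (nondecreasing_cvg_mu mF (bigcupT_measurable F mF)) => k l kl.
apply/subsetPset; apply: subset_itvl.
by rewrite bnd_simp lerD2l lerN2 lef_pV2 ?posrE// ler_nat.
Qed.

(** The Galois connection of quantile and distribution function. For [0 < p < 1] the set [S] is
    nonempty and bounded below, so its [inf] is genuine; right continuity shows that the infimum is
    attained. *)
Lemma quantile_le P (p : \bar R) c : (0 < p < 1)%E ->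
  (quantile P p <= c) = (p <= cdf1 P c)%E.
Proof.
move=> /andP[p0 p1]; set S := [set t | (p <= cdf1 P t)%E].
have [x px] : S !=set0.
  apply: contrapT => /forallNP h.
  suff : (1 <= p)%E by rewrite leNgt p1.
  by apply: (@cdf1_sup P) => x; rewrite leNgt; apply/negP => /ltW/h.
have [y py] : exists y, lbound S y.
  have [y yp] : exists y, (cdf1 P y < p)%E.
    apply: contrapT => /forallNP h.
    suff : (p <= 0)%E by rewrite leNgt p0.
    by apply: (@cdf1_inf P) => x'; rewrite leNgt; apply/negP/h.
  exists y => t; rewrite /S/= => pt; rewrite leNgt; apply/negP => ty.
  have := lt_le_trans yp (le_trans pt (cdf1_nondecreasing P (ltW ty))).
  by rewrite ltxx.
have hS : has_inf S by split; [exists x|exists y].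
apply/idP/idP => [Qc|pc]; last by apply: ge_inf => //; exists y.
apply: (@cdf1_right_ge P) => t ct.
have [u pu /ltW ut] := inf_lt (ex_intro _ x px) (le_lt_trans Qc ct).
exact: le_trans pu (cdf1_nondecreasing P ut).
Qed.

Lemma cdf1_measurable P : measurable_fun setT (cdf1 P).
Proof. exact: (@cdf_measurable _ _ _ P idTR). Qed.

Lemma measurable_cdf1_sublevel P p : measurable [set t | (cdf1 P t <= p)%E].
Proof.
rewrite -[X in measurable X]setTI.
exact: (emeasurable_fun_infty_c measurableT (@cdf1_measurable P) p).
Qed.

End cdf.

(** * Monotone transport from an atomless measure *)

Section transport1.
Context {R : realType} (alpha beta : probability R R).
Hypothesis atomless : forall c, alpha [set c] = 0%E.
Local Notation F := (cdf1 alpha).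
Local Notation T := (transport1 alpha beta).

Lemma atomless_itv_open c : alpha `]-oo, c[%classic = F c.
Proof.
rewrite /cdf1 -(@setUitv1 _ _ -oo%O c true)// measureU//.
  by rewrite [X in (_ + X)%E]atomless adde0.
apply/seteqP; split=> // x [/= + xc]; rewrite xc in_itv/= ltxx.
by [].
Qed.

(** The probability integral transform: [F] is uniform on [[0, 1]] under [alpha]. The sublevel set
    is a lower ray; if empty it forces [p = 0], if unbounded above [p = 1]. Otherwise, at its
    supremum [s], right continuity and the absence of an atom give [F s = p]. *)
Lemma cdf1_sublevel (p : \bar R) : (0 <= p <= 1)%E ->
  alpha [set t | (F t <= p)%E] = p.
Proof.
move=> /andP[p0 p1]; set S := [set t | _].
have Sd x y : x <= y -> S y -> S x.
  by move=> xy; apply: le_trans; exact: cdf1_nondecreasing.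
have [S0|] := pselect (S !=set0); last first.
  move=> /forallNP nS.
  have -> : S = set0 by apply/seteqP; split=> // x /nS.
  rewrite measure0; apply/eqP; rewrite eq_le p0 andTb.
  by apply: (@cdf1_inf _ alpha) => x; rewrite leNgt; apply/negP => /ltW /nS.
have [Sub|nub] := pselect (has_ubound S); last first.
  have ST : S = setT.
    apply/seteqP; split=> // x _; apply: contrapT => nSx; apply: nub.
    exists x => y Sy; rewrite leNgt; apply/negP => /ltW xy.
    by apply: nSx; exact: Sd xy Sy.
  rewrite ST probability_setT; apply/eqP; rewrite eq_le p1 andbT.
  by apply: (@cdf1_sup _ alpha) => x; have : S x by rewrite ST.
have hS : has_sup S by [].
set s := sup S.
have lts x : x < s -> S x.
  by move=> /(sup_gt S0)[y Sy /ltW xy]; exact: Sd xy Sy.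
have gts x : s < x -> ~ S x.
  by move=> sx Sx; move: sx; rewrite ltNge => /negP; apply; exact: ub_le_sup.
have Fsp : F s = p.
  apply/eqP; rewrite eq_le; apply/andP; split.
    by rewrite -atomless_itv_open; exact: cdf1_left_le.
  apply: cdf1_right_ge => x /gts nSx.
  by rewrite leNgt; apply/negP => /ltW/nSx.
rewrite -Fsp; congr (alpha _); apply/seteqP; split => x.
  by move=> Sx; rewrite /= in_itv/= leNgt; apply/negP => /gts.
by rewrite /= in_itv/= => xs; rewrite /S /= -Fsp; exact: cdf1_nondecreasing.
Qed.

(* Off D the quantile may be the junk value [inf set0] or the infimum of a set
   unbounded below. *)
Let D := [set t | (0 < F t < 1)%E].

Let mF0 : measurable [set t | (F t <= 0)%E].
Proof. exact: measurable_cdf1_sublevel. Qed.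

Let mF1 : measurable [set t | (1 <= F t)%E].
Proof.
rewrite -[X in measurable X]setTI.
exact: (emeasurable_fun_c_infty measurableT (@cdf1_measurable _ alpha) 1%E).
Qed.

Let DE : ~` D = [set t | (F t <= 0)%E] `|` [set t | (1 <= F t)%E].
Proof.
apply/seteqP; split=> t /=.
  by move=> /negP; rewrite negb_and -!leNgt => /orP.
by move=> /orP h; apply/negP; rewrite negb_and -!leNgt.
Qed.

Let mD : measurable D.
Proof. by rewrite -[D]setCK DE; apply: measurableC; exact: measurableU. Qed.

(** The set where [1 <= F] lies in the one where [1 - e < F], which has mass [e] by uniformity when
    [e < 1]; [e] is arbitrary. *)
Let D0 : alpha (~` D) = 0%E.
Proof.
rewrite DE; apply/eqP; rewrite eq_le measure_ge0 andbT.
apply: (@le_trans _ _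
  (alpha [set t | (F t <= 0)%E] + alpha [set t | (1 <= F t)%E])%E).
  exact: measureU2.
rewrite cdf1_sublevel ?lexx ?lee01// add0e.
apply/lee_addgt0Pr => e e0; rewrite add0e.
have [e1|e1] := leP 1 e.
  by apply: le_trans (probability_le1 _ _) _; rewrite ?lee_fin.
have pe : (0 <= (1 - e)%:E <= 1)%E by rewrite !lee_fin; lra.
have -> : e%:E = alpha (~` [set t | (F t <= (1 - e)%:E)%E]).
  rewrite probability_setC ?cdf1_sublevel//; last exact: measurable_cdf1_sublevel.
  by rewrite -EFinB opprB addrC subrK.
apply: le_measure; rewrite ?inE//.
  by apply: measurableC; exact: measurable_cdf1_sublevel.
move=> t /= F1 /(le_trans F1); rewrite lee_fin; lra.
Qed.


Let null_D A : measurable A -> alpha A = alpha (A `&` D).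
Proof.
move=> mA; have AD : alpha (A `\` D) = 0%E.
  apply: (@subset_measure0 _ _ _ alpha _ (~` D)) => //; rewrite ?inE.
  - exact: measurableD.
  - exact: measurableC.
by rewrite -[RHS]add0e -AD; exact: measureDI.
Qed.

Let T_sublevel c :
  [set t | T t <= c] `&` D = [set t | (F t <= cdf1 beta c)%E] `&` D.
Proof.
by apply/seteqP; split=> t [/= Tc Dt]; split=> //; move: Tc;
  rewrite /= /transport1 /= quantile_le.
Qed.

(** On [D] this is a sublevel set of [F]. On each of the two pieces of the complement [F] is
    constant, hence so is [T], whatever junk value the quantile takes, and the sublevel set contains
    or misses the whole piece. *)
Let mT_sublevel c : measurable [set t | T t <= c].
Proof.
have const_part (p : \bar R) (A : set R) :
    measurable A -> (forall t, A t -> F t = p) ->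
    measurable ([set t | T t <= c] `&` A).
  move=> mA FA; have [Tc|Tc] := boolP (quantile beta p <= c).
    rewrite [X in measurable X](_ : _ = A)//; apply/seteqP; split=> [t []//|t At].
    by split=> //; rewrite /= /transport1/= (FA t At).
  rewrite [X in measurable X](_ : _ = set0)//; apply/seteqP; split=> // t [/=].
  by move=> + At; rewrite /transport1/= (FA t At); apply/negP.
rewrite -[X in measurable X]setIT -(setvU D) setIUr T_sublevel DE setIUr.
have mDc : measurable ([set t | (F t <= cdf1 beta c)%E] `&` D).
  exact: (measurableI _ _ (measurable_cdf1_sublevel _ _) mD).
apply: measurableU mDc.
apply: measurableU.
  apply: (const_part 0%E) => // t /= Ft; apply/eqP.
  by rewrite eq_le Ft cdf1_ge0.
apply: (const_part 1%E) => // t /= Ft; apply/eqP.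
by rewrite eq_le Ft cdf1_le1.
Qed.

Lemma measurable_transport1 : measurable_fun setT T.
Proof.
apply: (@measurability _ _ _ R _ _ _ (RGenOInfty.measurableE R)).
move=> _ [_ [x ->] <-].
rewrite setTI [X in measurable X](_ : _ = ~` [set t | T t <= x]).
  exact: measurableC.
by apply/seteqP; split=> t /=; rewrite in_itv/= andbT ltNge => /negP.
Qed.

(** Up to a null set, [T t <= c] means [F t <= cdf1 beta c], and [F] is uniform. *)
Lemma transport1_sublevel c : alpha [set t | T t <= c] = cdf1 beta c.
Proof.
rewrite null_D// T_sublevel -null_D; last exact: measurable_cdf1_sublevel.
by rewrite cdf1_sublevel// cdf1_ge0 cdf1_le1.
Qed.

Lemma transport1_pushforward A : measurable A -> alpha (T @^-1` A) = beta A.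
Proof.
move=> mA; rewrite -[LHS]/(pushforward_probability alpha measurable_transport1 A).
apply: probability_cdf_eq => // c; rewrite -[RHS]/(cdf1 beta c).
by rewrite -transport1_sublevel; congr (alpha _).
Qed.

End transport1.

(** * Optimal translations *)

Section image_measure.
Context d d' (T : measurableType d) (T' : measurableType d') (R : realType).
Variables (P : probability T R) (Q : probability T' R) (phi : T -> T').
Hypothesis mphi : measurable_fun setT phi.
Hypothesis PQ : forall A, measurable A -> P (phi @^-1` A) = Q A.

(** Only the values on measurable sets are compared, so this serves the marginals of a coupling as
    well as pushforwards. *)
Lemma ge0_integral_image (f : T' -> \bar R) : measurable_fun setT f ->
  (forall y, (0 <= f y)%E) ->
  (\int[P]_x f (phi x) = \int[Q]_y f y)%E.
Proof.
move=> mf f0; rewrite (eq_measure_integral (pushforward_probability P mphi)).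
  by rewrite ge0_integral_pushforward.
by move=> A mA _; exact/esym/PQ.
Qed.

Lemma integrable_image (f : T' -> \bar R) :
  Q.-integrable setT f -> P.-integrable setT (f \o phi).
Proof.
move=> /integrableP[mf fi]; apply/integrableP; split.
  exact: measurableT_comp.
rewrite (ge0_integral_image (f := fun y => `|f y|%E))//.
exact: measurableT_comp.
Qed.

Lemma integral_image (f : T' -> \bar R) : Q.-integrable setT f ->
  (\int[P]_x f (phi x) = \int[Q]_y f y)%E.
Proof.
move=> fi; have [mf _] := integrableP _ _ _ fi.
rewrite (eq_measure_integral (pushforward_probability P mphi)).
  rewrite integral_pushforward//; exact: integrable_image.
by move=> A mA _; exact/esym/PQ.
Qed.

End image_measure.

(** * Means and second moments *)

Section second_moment.
Context {R : realType} {n : nat}.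
Implicit Types mu : probability 'cV[R]_n R.

Lemma coord_sqr_le (x : 'cV[R]_n) i : x i 0 ^+ 2 <= enorm x ^+ 2.
Proof.
rewrite enorm_sqr /dotv (bigD1 i)//= -expr2 lerDl sumr_ge0// => j _.
by rewrite -expr2 sqr_ge0.
Qed.

Lemma measurable_enorm_sqr d (T : measurableType d) (f : T -> 'cV[R]_n) :
  measurable_fun setT f -> measurable_fun setT (fun x => (enorm (f x) ^+ 2)%:E).
Proof.
move=> mf; apply/measurable_EFinP; under eq_fun do rewrite enorm_sqr.
exact: measurable_dotv.
Qed.

Lemma integrable_enorm_sqr mu : W2space mu ->
  mu.-integrable setT (fun x => (enorm x ^+ 2)%:E).
Proof.
move=> mu2; apply/integrableP; split; first exact: measurable_enorm_sqr.
by under eq_integral do rewrite gee0_abs ?lee_fin ?sqr_ge0//.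
Qed.

Lemma integrable_coord mu i : W2space mu ->
  mu.-integrable setT (fun x => (x i 0)%:E).
Proof.
(* Domination by [|t| <= 1 + t^2]. *)
move=> mu2; apply: (@le_integrable _ _ _ _ _ _ _
  (fun x : 'cV[R]_n => 1%:E + (enorm x ^+ 2)%:E)%E) => //.
- by apply/measurable_EFinP; exact: measurable_coord.
- move=> x _ /=; rewrite lee_fin.
  rewrite [leRHS]ger0_norm ?addr_ge0 ?sqr_ge0//.
  have := coord_sqr_le x i; rewrite -[x i 0 ^+ 2]real_normK ?num_real//.
  have := normr_ge0 (x i 0); nra.
- apply: integrableD => //; last exact: integrable_enorm_sqr.
  exact: (finite_measure_integrable_cst _ 1).
Qed.

Definition mean mu : 'cV[R]_n := \col_i fine (\int[mu]_x (x i 0)%:E)%E.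

Lemma integral_coord mu i : W2space mu ->
  (\int[mu]_x (x i 0)%:E = (mean mu i 0)%:E)%E.
Proof.
by move=> mu2; rewrite mxE fineK// integrable_fin_num// integrable_coord.
Qed.

Lemma enorm_sqrD (x y : 'cV[R]_n) :
  enorm (x + y) ^+ 2 = enorm x ^+ 2 + \sum_i (2 * y i 0) * x i 0 + enorm y ^+ 2.
Proof.
rewrite !enorm_sqr /dotv -!big_split/=; apply: eq_bigr => i _.
by rewrite !mxE; ring.
Qed.

(** By the parallelogram law the difference of the two sides is the squared norm of [x + y]. *)
Lemma enorm_sqrB_le (x y : 'cV[R]_n) :
  enorm (x - y) ^+ 2 <= 2 * enorm x ^+ 2 + 2 * enorm y ^+ 2.
Proof.
rewrite !enorm_sqr /dotv !mulr_sumr -big_split/=; apply: ler_sum => i _.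
by rewrite !mxE; have := sqr_ge0 (x i 0 + y i 0); lra.
Qed.

End second_moment.

(** * Cost of a coupling under a shift *)

Section coupling_cost.
Context {R : realType} {n : nat}.
Implicit Types alpha beta : probability 'cV[R]_n R.

Definition cost (pi : probability ('cV[R]_n * 'cV[R]_n)%type R) : \bar R :=
  (\int[pi]_z (enorm (z.1 - z.2) ^+ 2)%:E)%E.

(** The cost is dominated by the second moments of the marginals; its finiteness allows the expanded
    square to be integrated term by term. *)
Lemma cost_lty alpha beta pi : W2space alpha -> W2space beta ->
  coupling alpha beta pi -> (cost pi < +oo)%E.
Proof.
move=> a2 b2 hpi.
have ia := integrable_image measurable_fst (fun A mA => (hpi A mA).1)
  (integrable_enorm_sqr a2).
have ib := integrable_image measurable_snd (fun A mA => (hpi A mA).2)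
  (integrable_enorm_sqr b2).
apply: integrable_lty => //; apply: (@le_integrable _ _ _ _ _ _ _
  (fun z : 'cV[R]_n * 'cV[R]_n =>
     2%:E * (enorm z.1 ^+ 2)%:E + 2%:E * (enorm z.2 ^+ 2)%:E)%E) => //.
- by apply: measurable_enorm_sqr; exact: measurable_colB.
- move=> z _ /=; rewrite lee_fin ger0_norm ?sqr_ge0// ger0_norm.
    exact: enorm_sqrB_le.
  by rewrite addr_ge0// mulr_ge0// sqr_ge0.
- by apply: integrableD => //; exact: integrableZl.
Qed.

(* Equality of the means kills the cross term of the square. *)
Lemma integral_enorm_sqr_shift alpha beta pi (v : 'cV[R]_n) :
  W2space alpha -> W2space beta -> mean alpha = mean beta ->
  coupling alpha beta pi ->
  (\int[pi]_z (enorm (z.1 + v - z.2) ^+ 2)%:E = cost pi + (enorm v ^+ 2)%:E)%E.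
Proof.
move=> a2 b2 mab hpi.
have p1 A (mA : measurable A) := (hpi A mA).1.
have p2 A (mA : measurable A) := (hpi A mA).2.
have i1 i : pi.-integrable setT (fun z => (z.1 i 0)%:E).
  exact: (integrable_image measurable_fst p1 (integrable_coord i a2)).
have i2 i : pi.-integrable setT (fun z => (z.2 i 0)%:E).
  exact: (integrable_image measurable_snd p2 (integrable_coord i b2)).
have i12 i : pi.-integrable setT (fun z => (z.1 i 0)%:E - (z.2 i 0)%:E)%E.
  exact: integrableB.
have ic : pi.-integrable setT (fun z => (enorm (z.1 - z.2) ^+ 2)%:E).
  apply/integrableP; split.
    by apply: measurable_enorm_sqr; exact: measurable_colB.
  under eq_integral do rewrite gee0_abs ?lee_fin ?sqr_ge0//.
  exact: cost_lty a2 b2 hpi.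
have i12v i : pi.-integrable setT
    (fun z => (2 * v i 0)%:E * ((z.1 i 0)%:E - (z.2 i 0)%:E))%E.
  exact: integrableZl.
have isum : pi.-integrable setT
    (fun z => \sum_i (2 * v i 0)%:E * ((z.1 i 0)%:E - (z.2 i 0)%:E))%E.
  exact: integrable_sum.
have iv : pi.-integrable setT (fun=> (enorm v ^+ 2)%:E).
  exact: finite_measure_integrable_cst.
have cross0 i :
    (\int[pi]_z ((2 * v i 0)%:E * ((z.1 i 0)%:E - (z.2 i 0)%:E)) = 0)%E.
  rewrite (integralZl _ (i12 i))// (integralB_EFin _ (i1 i) (i2 i))//.
  rewrite (integral_image measurable_fst p1 (integrable_coord i a2)).
  rewrite (integral_image measurable_snd p2 (integrable_coord i b2)).
  by rewrite !integral_coord// mab subee// mule0.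
transitivity (\int[pi]_z ((enorm (z.1 - z.2) ^+ 2)%:E +
    \sum_i (2 * v i 0)%:E * ((z.1 i 0)%:E - (z.2 i 0)%:E) + (enorm v ^+ 2)%:E))%E.
  apply: eq_integral => z _; rewrite addrAC (enorm_sqrD (z.1 - z.2)).
  rewrite !EFinD -sumEFin.
  by congr (_ + _ + _)%E; apply: eq_bigr => i _; rewrite !mxE.
rewrite integralD//; last exact: integrableD.
rewrite integralD// integral_sum// integral_cst//= probability_setT mule1.
by rewrite big1 ?adde0.
Qed.

End coupling_cost.

(** * The optimal translation *)

Section argmin.
Context {R : realType} {n : nat}.
Implicit Types sigma eta : probability 'cV[R]_n R.

Lemma measurable_translation (b : 'cV[R]_n) :
  measurable_fun setT (fun x : 'cV[R]_n => x + b).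
Proof. by apply: measurable_colD. Qed.

Definition translate sigma (b : 'cV[R]_n) :=
  pushforward_probability sigma (measurable_translation b).

Lemma W2space_translate sigma b : W2space sigma -> W2space (translate sigma b).
Proof.
move=> s2; rewrite /W2space/=.
rewrite -(ge0_integral_image (P := sigma) (Q := translate sigma b)
  (measurable_translation b) (fun A mA => erefl)); first last.
- by move=> y; rewrite lee_fin sqr_ge0.
- exact: measurable_enorm_sqr.
apply: integrable_lty => //; apply: (@le_integrable _ _ _ _ _ _ _
  (fun x : 'cV[R]_n =>
     2%:E * (enorm x ^+ 2)%:E + (2 * enorm (- b) ^+ 2)%:E)%E) => //.
- exact: measurable_enorm_sqr (measurable_translation b).
- move=> z _ /=; rewrite lee_fin ger0_norm ?sqr_ge0// ger0_norm.
    by rewrite -{1}[b]opprK enorm_sqrB_le.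
  by rewrite addr_ge0// mulr_ge0// sqr_ge0.
- apply: integrableD => //; last exact: finite_measure_integrable_cst.
  by apply: integrableZl => //; exact: integrable_enorm_sqr.
Qed.

Lemma mean_translate sigma b : W2space sigma ->
  mean (translate sigma b) = mean sigma + b.
Proof.
move=> s2; apply/colP => i; rewrite [LHS]mxE [RHS]mxE.
rewrite -(integral_image (P := sigma) (Q := translate sigma b)
  (measurable_translation b)
  (fun A mA => erefl) (integrable_coord i (W2space_translate b s2))).
under eq_integral do rewrite mxE EFinD.
rewrite integralD//; last 2 first.
- exact: integrable_coord.
- exact: finite_measure_integrable_cst.
by rewrite integral_cst//= probability_setT mule1 integral_coord.
Qed.

(** Here [pi'] is the image of [pi] under [(x, y) |-> (x - v, y)]; adding [v] back in the integrand
    restores the cost. *)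
Lemma coupling_translate sigma eta b v pi :
  coupling (translate sigma b) eta pi ->
  exists2 pi', coupling (translate sigma (b - v)) eta pi' &
    cost pi = (\int[pi']_z (enorm (z.1 + v - z.2) ^+ 2)%:E)%E.
Proof.
move=> hpi; pose f (z : 'cV[R]_n * 'cV[R]_n) := (z.1 - v, z.2).
have mf : measurable_fun setT f.
  apply/measurable_fun_pairP; split; last exact: measurable_snd.
  exact: (measurable_colB measurable_fst (measurable_cst v)).
exists (pushforward_probability pi mf).
  move=> A mA; split; last exact: (hpi A mA).2.
  pose B := [set x : 'cV[R]_n | A (x - v)].
  have mB : measurable B.
    by rewrite -[B]setTI; apply: (measurable_translation (- v)).
  rewrite [LHS](hpi B mB).1.
  by congr (sigma _); apply/seteqP; split=> x; rewrite /B /= addrA.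
rewrite -(ge0_integral_image (Q := pushforward_probability pi mf) mf
  (fun A mA => erefl)).
- by apply: eq_integral => z _; rewrite /f/= subrK.
- apply: measurable_enorm_sqr.
  by apply: measurable_colB => //; exact: measurable_colD.
- by move=> y; rewrite lee_fin sqr_ge0.
Qed.

(** Shifting by [v = b - b0] makes the means of the two marginals equal, so the cross term
    vanishes. *)
Lemma W2_gap sigma eta b pi : W2space sigma -> W2space eta ->
  coupling (translate sigma b) eta pi ->
  let b0 := mean eta - mean sigma in
  exists2 pi', coupling (translate sigma b0) eta pi' &
    cost pi = (cost pi' + (enorm (b - b0) ^+ 2)%:E)%E.
Proof.
move=> s2 e2 hpi b0; have [pi'] := coupling_translate (b - b0) hpi.
rewrite subKr => hpi' ->; exists pi' => //.
apply: integral_enorm_sqr_shift hpi' => //; first exact: W2space_translate.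
by rewrite mean_translate// /b0 addrC subrK.
Qed.

Lemma dotv_gt0 (x : 'cV[R]_n) : x != 0 -> 0 < dotv x x.
Proof.
have sq_ge0 i : true -> 0 <= x i 0 * x i 0 by rewrite -expr2 sqr_ge0.
move=> x0; rewrite lt_def sumr_ge0 ?andbT//.
apply: contra x0; rewrite psumr_eq0// => /allP h.
apply/eqP/colP => i; rewrite mxE; apply/eqP; rewrite -sqrf_eq0 expr2.
by apply: h; rewrite mem_index_enum.
Qed.

(** Couplings exist, so the infimum in [W2] runs over a nonempty set. *)
Lemma coupling_product (alpha beta : probability 'cV[R]_n R) :
  coupling alpha beta (alpha \x beta)%E.
Proof.
move=> A mA; split.
  rewrite -setXT; apply: etrans (product_measure1E alpha beta mA measurableT) _.
  by rewrite /= probability_setT mule1.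
rewrite -setTX; apply: etrans (product_measure1E alpha beta measurableT mA) _.
by rewrite /= probability_setT mul1e.
Qed.

Lemma cost_ge0 (pi : probability ('cV[R]_n * 'cV[R]_n)%type R) :
  (0 <= cost pi)%E.
Proof. by apply: integral_ge0 => z _; rewrite lee_fin sqr_ge0. Qed.

(** The gap identity holds coupling by coupling; bounding the cost at [b0] below by [w ^+ 2] and
    then taking the infimum over couplings gives the estimate. *)
Lemma W2_translate_ge sigma eta : W2space sigma -> W2space eta ->
  let b0 := mean eta - mean sigma in
  exists w : R, [/\ 0 <= w, W2 (translate sigma b0) eta = w%:E &
    forall b, ((Num.sqrt (w ^+ 2 + enorm (b - b0) ^+ 2))%:E <=
      W2 (translate sigma b) eta)%E].
Proof.
move=> s2 e2 b0.
have costE b pi : coupling (translate sigma b) eta pi ->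
    exists2 c : R, 0 <= c & cost pi = c%:E.
  move=> hpi; have := cost_lty (W2space_translate b s2) e2 hpi.
  by have := cost_ge0 pi; case: (cost pi) => // c c0 _; exists c.
have W0 : (0 <= W2 (translate sigma b0) eta)%E.
  by apply: le_ereal_inf_tmp => _ [pi _ <-]; exact: poweR_ge0.
(* Finiteness matters: with an infinite distance the estimate could not separate [b] from [b0]. *)
have Wy : (W2 (translate sigma b0) eta < +oo)%E.
  have hpi := coupling_product (translate sigma b0) eta.
  have [c c0 cE] := costE _ _ hpi.
  apply: le_lt_trans (ereal_inf_lbound _) (ltry (c `^ 2^-1)).
  by exists (translate sigma b0 \x eta)%E => //; rewrite -poweR_EFin -cE.
move: W0 Wy; case WE : (W2 (translate sigma b0) eta) => [w| |] // w0 _.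
exists w; split => // b; apply: le_ereal_inf_tmp => _ [pi hpi <-].
have [pi' hpi' costD] := W2_gap s2 e2 hpi.
have [c c0 cE] := costE _ _ hpi'.
rewrite -/(cost pi) costD cE -EFinD poweR_EFin powR12_sqrt ?addr_ge0 ?sqr_ge0//.
rewrite lee_fin ler_sqrt ?addr_ge0 ?sqr_ge0// lerD2r.
have : (w%:E <= (c `^ 2^-1)%:E)%E.
  by rewrite -WE -poweR_EFin -cE; apply: ereal_inf_lbound; exists pi'.
rewrite powR12_sqrt// lee_fin => wc.
by rewrite -(sqr_sqrtr c0) ler_sqr ?nnegrE ?sqrtr_ge0.
Qed.

Lemma W2_argmin_translations sigma eta : W2space sigma -> W2space eta ->
  W2_argmin (@translations R n) sigma eta =
    [set (fun x => x + (mean eta - mean sigma))].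
Proof.
move=> s2 e2; set b0 := mean eta - mean sigma.
have [w [w0 Ww Wge]] := W2_translate_ge s2 e2.
have Wle b : (W2 (translate sigma b0) eta <= W2 (translate sigma b) eta)%E.
  apply: le_trans (Wge b); rewrite Ww lee_fin -[leLHS]ger0_norm// -sqrtr_sqr.
  by rewrite ler_wsqrtr// lerDl sqr_ge0.
apply/seteqP; split=> [_ [[b _ <-] bmin]|_ ->]; last first.
  by split=> [|_ [b _ <-]]; [exists b0|exact: Wle].
suff -> : b = b0 by [].
(* For [b != b0] the lower bound [sqrt (w^2 + |b - b0|^2)] strictly exceeds [w], so [b] cannot be a
   minimizer. *)
apply/eqP; rewrite -subr_eq0; apply/negPn/negP => bb0.
have : (W2 (translate sigma b) eta <= W2 (translate sigma b0) eta)%E.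
  by apply: bmin; exists b0.
rewrite leNgt => /negP; apply; apply: lt_le_trans (Wge b).
rewrite Ww lte_fin -[ltLHS]ger0_norm// -sqrtr_sqr ltr_sqrt.
  rewrite ltrDl enorm_sqr; exact: dotv_gt0.
rewrite ltr_wpDl ?sqr_ge0// enorm_sqr; exact: dotv_gt0.
Qed.

End argmin.

(** * Slices along an orthonormal basis *)

Section orthogonal_slices.
Context {R : realType} {n : nat} (P : 'M[R]_n).
Hypothesis hP : orthogonal_group P.
Implicit Types mu eta sigma : probability 'cV[R]_n R.

Lemma dotv_col (x : 'cV[R]_n) i : dotv x (col i P) = (P^T *m x) i 0.
Proof. by rewrite mxE; apply: eq_bigr => j _; rewrite !mxE mulrC. Qed.

Lemma col_neq0 i : col i P != 0.
Proof.
apply/eqP => Pi0; have /matrixP/(_ i i) := hP; rewrite !mxE eqxx big1.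
  by move/eqP; rewrite eq_sym oner_eq0.
by move=> k _; have /colP/(_ k) := Pi0; rewrite !mxE => ->; rewrite mulr0.
Qed.

Lemma dotv_trmxE (x y : 'cV[R]_n) : dotv x y = (x^T *m y) 0 0.
Proof. by rewrite mxE; apply: eq_bigr => i _; rewrite mxE. Qed.

(** Parseval's identity for the columns of [P]; for square matrices [P^T *m P = 1] also gives
    [P *m P^T = 1]. *)
Lemma enorm_sqr_slices (x : 'cV[R]_n) :
  enorm x ^+ 2 = \sum_i dotv x (col i P) ^+ 2.
Proof.
transitivity (dotv (P^T *m x) (P^T *m x)).
  rewrite enorm_sqr !dotv_trmxE trmx_mul trmxK -mulmxA (mulmxA P).
  by rewrite (mulmx1C hP) mul1mx.
by apply: eq_bigr => i _; rewrite dotv_col expr2.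
Qed.

Lemma measurable_slice i :
  measurable_fun setT (fun x : 'cV[R]_n => dotv x (col i P)).
Proof. exact: measurable_dotv. Qed.

Definition slice_probability mu i : probability R R :=
  pushforward_probability mu (measurable_slice i).

Lemma integral_enorm_sqr_slices mu :
  (\int[mu]_x (enorm x ^+ 2)%:E =
    \sum_i \int[slice_probability mu i]_s (s ^+ 2)%:E)%E.
Proof.
under eq_integral do rewrite enorm_sqr_slices -sumEFin.
have mf i :
    measurable_fun setT (fun x : 'cV[R]_n => (dotv x (col i P) ^+ 2)%:E).
  by apply/measurable_EFinP; apply: measurable_funX; exact: measurable_slice.
rewrite ge0_integral_sum//; last by move=> i x _; rewrite lee_fin sqr_ge0.
apply: eq_bigr => i _.
rewrite -(ge0_integral_image (P := mu) (Q := slice_probability mu i)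
  (measurable_slice i) (fun A mA => erefl))//.
- by apply/measurable_EFinP; exact: measurable_funX.
- by move=> s; rewrite lee_fin sqr_ge0.
Qed.

Lemma integral_id_slice mu i : W2space mu ->
  (\int[slice_probability mu i]_s s%:E = ((P^T *m mean mu) i 0)%:E)%E.
Proof.
move=> mu2.
have ic j : mu.-integrable setT (fun x => (P j i)%:E * (x j 0)%:E)%E.
  by apply: integrableZl => //; exact: integrable_coord.
have dE : (fun x => (dotv x (col i P))%:E) =
    (fun x => \sum_j (P j i)%:E * (x j 0)%:E)%E.
  apply/funext => x; rewrite -sumEFin; apply: eq_bigr => j _.
  by rewrite !mxE mulrC.
have ix : mu.-integrable setT (fun x => (dotv x (col i P))%:E).
  by rewrite dE; exact: integrable_sum.
rewrite /slice_probability pushforward_probabilityE.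
rewrite (integral_pushforward (measurable_slice i))//= dE.
rewrite (integral_sum _ (fun j => ic j))// mxE -sumEFin; apply: eq_bigr => j _.
by rewrite integralZl ?integral_coord ?mxE//; exact: integrable_coord.
Qed.

(** The second moment is the sum of those of the slices, and the slice means are the entries of
    [P^T *m mean], from which multiplication by [P] recovers the mean. *)
Lemma W2space_mean_slices mu eta :
  (forall i A, measurable A -> slice eta (col i P) A = slice mu (col i P) A) ->
  W2space mu -> W2space eta /\ mean eta = mean mu.
Proof.
move=> emu mu2.
have sE i (f : R -> \bar R) : (\int[slice_probability eta i]_s f s =
    \int[slice_probability mu i]_s f s)%E.
  by apply: eq_measure_integral => A mA _; exact: emu.
have eta2 : W2space eta.
  rewrite /W2space/= integral_enorm_sqr_slices.
  by under eq_bigr do rewrite sE; rewrite -integral_enorm_sqr_slices.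
split => //; rewrite -[LHS]mul1mx -[RHS]mul1mx -(mulmx1C hP) -!mulmxA.
congr (_ *m _); apply/colP => i; apply: EFin_inj.
by rewrite -!integral_id_slice.
Qed.

End orthogonal_slices.

(** * Slices of the matched measure *)

Lemma slice_transportE (R : realType) n (sigma mu : set 'cV[R]_n -> \bar R)
    (P : 'M[R]_n) x :
  slice_transport sigma mu P x = P *m \col_i
    transport1 (slice sigma (col i P)) (slice mu (col i P)) (dotv x (col i P)).
Proof.
apply/colP => k; rewrite summxE mxE; apply: eq_bigr => i _.
by rewrite !mxE mulrC.
Qed.

Lemma dotv_slice_transport (R : realType) n (sigma mu : set 'cV[R]_n -> \bar R)
    (P : 'M[R]_n) x i : orthogonal_group P ->
  dotv (slice_transport sigma mu P x) (col i P) =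
    transport1 (slice sigma (col i P)) (slice mu (col i P)) (dotv x (col i P)).
Proof.
by move=> hP; rewrite dotv_col slice_transportE mulmxA hP mul1mx mxE.
Qed.

Section matched_slices.
Context {R : realType} {m : nat} (sigma mu : probability 'cV[R]_m.+1 R).
Context (P : 'M[R]_m.+1).
Hypotheses (hsigma : W2ac sigma) (hP : orthogonal_group P).

Let slice_null i c : slice_probability P sigma i [set c] = 0%E.
Proof. exact: slice_atomless hsigma (col_neq0 hP i). Qed.

Lemma measurable_slice_transport :
  measurable_fun setT (slice_transport sigma mu P).
Proof.
apply: measurable_col => k; under eq_fun do rewrite slice_transportE mxE.
apply: measurable_sum => i; apply: measurable_funM; first exact: measurable_cst.
under eq_fun do rewrite mxE.
have mT := measurable_transport1
  (slice_probability P sigma i) (slice_probability P mu i).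
exact: (measurableT_comp mT (measurable_slice P i)).
Qed.

(** Projection onto the [i]-th column intertwines the slice transport with the one-dimensional
    transport, which carries the atomless slice of [sigma] to that of [mu]. *)
Lemma slice_slice_matching i A : measurable A ->
  slice (slice_matching sigma mu P) (col i P) A = slice mu (col i P) A.
Proof.
move=> mA.
rewrite -[RHS](transport1_pushforward (slice_probability P mu i)
  (slice_null i))//.
by congr (sigma _); apply/seteqP; split=> x; rewrite /= dotv_slice_transport.
Qed.

End matched_slices.

Theorem proposition5p1 (R : realType) (n : nat) (hn : (0 < n)%N)
    (sigma mu : probability 'cV[R]_n R) (P : 'M[R]_n)
    (hsigma : W2ac sigma) (hmu : W2space mu) (hP : orthogonal_group P) :
  [/\ exists! S, W2_argmin (@translations R n) sigma mu S,
      exists! S, W2_argmin (@translations R n) sigma (slice_matching sigma mu P) S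
    & W2_argmin (@translations R n) sigma mu =
      W2_argmin (@translations R n) sigma (slice_matching sigma mu P)].
Proof.
(* In positive dimension, written [m.+1], [lebesgue_n] is not degenerate and hyperplanes are
   null. *)
case: n hn sigma mu P hsigma hmu hP => // m _ sigma mu P hsigma hmu hP.
have [s2 _] := hsigma.
pose eta := pushforward_probability sigma (measurable_slice_transport sigma mu P).
have [eta2 eta_mean] : W2space eta /\ mean eta = mean mu.
  by apply: (W2space_mean_slices hP) hmu => i A; exact: slice_slice_matching.
(* By conversion the plain set function is replaced by the bundled [eta]; both argmin sets then
   become the same singleton. *)
rewrite -[slice_matching sigma mu P]/(eta : set _ -> \bar R).
rewrite !W2_argmin_translations// eta_mean.
by split=> //; eexists; split.
Qed.
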